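(* In the setting of the context, suppose the regularity assumption and the local worst-case oracle assumption hold, and fix $x\in\mathcal X$ (write $\ell_k(z)=\ell_k(x,z)$), $k\in[K]$ and $i\in[N]$. For $u\ge0$ let $$S_k(u;\hat z_i)=\max\{\ell_k(\hat z_i+v):v\in\mathbb R^m,\ \hat z_i+v\in\mathcal Z,\ c(\hat z_i+v,\hat z_i)\le u\}.$$ Then for every $u\ge0$: if $p=1$, $$S_k(u;\hat z_i)-S_k(0;\hat z_i)\le C_i+g\,u^r;$$ and for every $p\ge1$, $$S_k(u;\hat z_i)-S_k(0;\hat z_i)\le G_i\,u^{1/p},$$ where $C_i:=\max_{k\in[K]}\{g+g\|\hat z_i-\hat z_0\|^r-\ell_k(\hat z_i)\}$, $G_i:=\max_{k\in[K]}\max\{\|\xi\|_*:\xi\in\partial\ell_k(\hat z_i)\}$, and $g,\hat z_0,r$ are the constant, reference point and exponent from part (iii) of the regularity assumption for the fixed $x$ (case $p=1$).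
   Context: Notation: $[n]=\{1,\dots,n\}$; $\mathcal P(\mathcal Z)$ is the set of Borel probability measures on $\mathcal Z$; $\|\cdot\|_*$ is the dual norm of the norm $\|\cdot\|$ below; $\partial\ell_k(\hat z_i)$ is the superdifferential of the concave function $\ell_k$ at $\hat z_i$; $0^0=1$. Setting. $\mathcal X\subseteq\mathbb R^n$, $\mathcal Z\subseteq\mathbb R^m$. A transportation cost $c:\mathcal Z\times\mathcal Z\to\mathbb R_+$ is lower semicontinuous, satisfies $c(z,z)=0$ for all $z$, and $c(\cdot,\hat z)$ is convex for every fixed $\hat z\in\mathcal Z$. The optimal transport discrepancy is $\mathrm{OT}_c(\mathbb P,\mathbb Q)=\min_{\gamma}\mathbb E_{(z,\hat z)\sim\gamma}[c(z,\hat z)]$ over couplings $\gamma$ of $\mathbb P$ and $\mathbb Q$. Given $\hat z_1,\dots,\hat z_N\in\mathcal Z$, let $\hat{\mathbb P}=\frac1N\sum_{i=1}^N\delta_{\hat z_i}$; given $\rho>0$, let $\mathcal P=\{\mathbb P\in\mathcal P(\mathcal Z):\mathrm{OT}_c(\mathbb P,\hat{\mathbb P})\le\rho\}$. Regularity assumption. (i) $\mathcal X$ is nonempty and convex; there exist $\mathbb Q_0\in\mathcal P$ and $x_0\in\mathcal X$ such that $x\mapsto\mathbb E_{z\sim\mathbb Q_0}[\ell(x,z)]$ is inf-compact on $\mathcal X$ (all sublevel sets are compact) and $\mathbb E_{z\sim\mathbb Q_0}[\ell(x_0,z)]>-\infty$; $\mathcal Z$ is nonempty, closed and convex. (ii)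 $\ell(x,z)=\max_{k\in[K]}\ell_k(x,z)$ with $K\ge2$, where each $\ell_k:\mathbb R^n\times\mathbb R^m\to\mathbb R$ is real-valued, convex in its first and concave in its second argument. (iii) There exist a norm $\|\cdot\|$ on $\mathbb R^m$ and $p\ge1$ with $c(z,\hat z)\ge\|z-\hat z\|^p$ for all $z,\hat z\in\mathcal Z$; moreover, if $p=1$, then for every $x\in\mathcal X$ there exist $g>0$, $\hat z_0\in\mathcal Z$ and $r\in[0,1)$ such that $\ell(x,z)\le g[1+\|z-\hat z_0\|^r]$ for all $z\in\mathcal Z$. Local worst-case oracle assumption. For any $k\in[K]$, $\hat z\in\mathcal Z$, radius $u\ge0$ and accuracy $\epsilon>0$ there is an algorithm that returns $\hat v\in\mathbb R^m$ with $\hat z+\hat v\in\mathcal Z$, $c(\hat z+\hat v,\hat z)\le u$, together with $\hat L=\ell_k(\hat z+\hat v)\ge\max\{\ell_k(\hat z+v):v\in\mathbb R^m,\hat z+v\in\mathcal Z,c(\hat z+v,\hat z)\le u\}-\epsilon$. *)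

(* Defs.v *)
From HB Require Import structures.
From mathcomp Require Import all_boot all_order all_algebra.
From mathcomp Require Import all_classical all_reals all_analysis.

Set Implicit Arguments.
Unset Strict Implicit.
Unset Printing Implicit Defensive.

Import Order.TTheory GRing.Theory Num.Theory.
Import numFieldNormedType.Exports.

Local Open Scope classical_set_scope.
Local Open Scope ring_scope.

Definition is_maximum (R : realType) (A : set R) (y : R) : Prop :=
  A y /\ ubound A y.

(* [max A]. The default value 0 is returned only when [A] has no greatest
   element, so a bound on [maximum A] requires proving attainment. *)
Definition maximum (R : realType) (A : set R) : R := xget 0 (is_maximum A).

Definition inner (R : realType) (m : nat) (u v : 'rV[R]_m) : R :=
  (u *m v^T) 0 0.

Record is_norm (R : realType) (m : nat) (nrm : 'rV[R]_m -> R) : Prop := {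
  norm_ge0 : forall v, 0 <= nrm v ;
  norm_definite : forall v, nrm v = 0 -> v = 0 ;
  norm_homogeneous : forall (a : R) v, nrm (a *: v) = `|a| * nrm v ;
  norm_triangle : forall v w, nrm (v + w) <= nrm v + nrm w }.

Definition dual_norm (R : realType) (m : nat) (nrm : 'rV[R]_m -> R)
    (xi : 'rV[R]_m) : R :=
  sup [set inner xi v | v in [set v | nrm v <= 1]].

Definition concave_function (R : realType) (m : nat) (f : 'rV[R]_m -> R) :
  Prop := convex_function setT (fun z => - f z).

Definition superdifferential (R : realType) (m : nat) (f : 'rV[R]_m -> R)
    (z : 'rV[R]_m) : set 'rV[R]_m :=
  [set xi | forall y, f y <= f z + inner xi (y - z)].

(* R^m with its Borel sigma-algebra. *)
Notation borelRV R m := (g_sigma_algebraType (@open 'rV[R]_m)).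

(* [c] is only meaningful on [Z `*` Z]: every condition is relative to [Z], and
   lower semicontinuity is with respect to the subspace topology. *)
Record transportation_cost (R : realType) (m : nat) (Z : set 'rV[R]_m)
    (c : 'rV[R]_m -> 'rV[R]_m -> R) : Prop := {
  cost_ge0 : forall z zh, Z z -> Z zh -> 0 <= c z zh ;
  cost_lsc : @lower_semicontinuous (subspace (Z `*` Z)) R
               (fun w => (c w.1 w.2)%:E) ;
  cost_diag : forall z, Z z -> c z z = 0 ;
  cost_convex : forall zh, Z zh -> convex_function Z (c ^~ zh) }.

Definition coupling (R : realType) (m : nat) (P Q : set (borelRV R m) -> \bar R)
    (gamma : probability (borelRV R m * borelRV R m)%type R) : Prop :=
  (forall A, measurable A -> gamma (A `*` setT) = P A) /\
  (forall B, measurable B -> gamma (setT `*` B) = Q B).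

Definition OT (R : realType) (m : nat) (Z : set 'rV[R]_m)
    (c : 'rV[R]_m -> 'rV[R]_m -> R)
    (P Q : set (borelRV R m) -> \bar R) : \bar R :=
  ereal_inf [set (\int[gamma]_(w in Z `*` Z) (c w.1 w.2)%:E)%E
            | gamma in coupling P Q].

Definition empirical (R : realType) (m N : nat) (zhat : 'I_N -> 'rV[R]_m)
    (A : set (borelRV R m)) : \bar R :=
  ((N%:R^-1)%:E * \sum_(i < N) \d_(zhat i : borelRV R m) A)%E.

(* Borel probability measures on [Z] are encoded as Borel probability measures
   on R^m giving mass 1 to [Z]. *)
Definition ambiguity_set (R : realType) (m N : nat) (Z : set 'rV[R]_m)
    (c : 'rV[R]_m -> 'rV[R]_m -> R) (zhat : 'I_N -> 'rV[R]_m) (rho : R) :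
    set (probability (borelRV R m) R) :=
  [set P | P Z = 1%E /\ (OT Z c P (empirical zhat) <= rho%:E)%E].

Definition inf_compact (R : realType) (n : nat) (X : set 'rV[R]_n)
    (F : 'rV[R]_n -> \bar R) : Prop :=
  forall a : R, compact [set x | X x /\ (F x <= a%:E)%E].

Definition loss (R : realType) (n m K : nat)
    (ell : 'I_K -> 'rV[R]_n -> 'rV[R]_m -> R) (x : 'rV[R]_n) (z : 'rV[R]_m) : R
  := maximum (range (fun k => ell k x z)).

Definition expected_loss (R : realType) (n m K : nat) (Z : set 'rV[R]_m)
    (ell : 'I_K -> 'rV[R]_n -> 'rV[R]_m -> R)
    (Q : probability (borelRV R m) R) (x : 'rV[R]_n) : \bar R :=
  (\int[Q]_(z in Z) (loss ell x z)%:E)%E.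

Definition growth_bound (R : realType) (m : nat) (Z : set 'rV[R]_m)
    (nrm : 'rV[R]_m -> R) (f : 'rV[R]_m -> R) (g : R) (z0 : 'rV[R]_m) (r : R) :
    Prop :=
  [/\ 0 < g, Z z0, 0 <= r < 1
    & forall z, Z z -> f z <= g * (1 + nrm (z - z0) `^ r)].

Record regularity (R : realType) (n m N K : nat) (X : set 'rV[R]_n)
    (Z : set 'rV[R]_m) (c : 'rV[R]_m -> 'rV[R]_m -> R)
    (zhat : 'I_N -> 'rV[R]_m) (rho : R)
    (ell : 'I_K -> 'rV[R]_n -> 'rV[R]_m -> R)
    (nrm : 'rV[R]_m -> R) (p : R) : Prop := {
  reg_X_nonempty : X !=set0 ;
  reg_X_convex : convex_set X ;
  reg_inf_compact : exists Q0 x0,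
    [/\ ambiguity_set Z c zhat rho Q0, X x0,
        inf_compact X (expected_loss Z ell Q0)
      & (-oo < expected_loss Z ell Q0 x0)%E] ;
  reg_Z_nonempty : Z !=set0 ;
  reg_Z_closed : closed Z ;
  reg_Z_convex : convex_set Z ;
  reg_K : (2 <= K)%N ;
  reg_ell_convex : forall k z, convex_function setT (ell k ^~ z) ;
  reg_ell_concave : forall k x, concave_function (ell k x) ;
  reg_norm : is_norm nrm ;
  reg_p : 1 <= p ;
  reg_cost : forall z zh, Z z -> Z zh -> nrm (z - zh) `^ p <= c z zh ;
  reg_growth : p = 1 -> forall x, X x ->
    exists g z0 r, growth_bound Z nrm (loss ell x) g z0 r }.

Definition local_worst_case (R : realType) (m : nat) (Z : set 'rV[R]_m)
    (c : 'rV[R]_m -> 'rV[R]_m -> R) (f : 'rV[R]_m -> R) (zh : 'rV[R]_m) (u : R) :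
    R :=
  maximum [set f (zh + v) | v in [set v | Z (zh + v) /\ c (zh + v) zh <= u]].

(* An algorithm is rendered by the existence of its output [(v, L)]. *)
Definition local_worst_case_oracle (R : realType) (m K : nat)
    (Z : set 'rV[R]_m) (c : 'rV[R]_m -> 'rV[R]_m -> R)
    (ell : 'I_K -> 'rV[R]_m -> R) : Prop :=
  forall (k : 'I_K) (zh : 'rV[R]_m) (u eps : R), Z zh -> 0 <= u -> 0 < eps ->
    exists (v : 'rV[R]_m) (L : R),
      [/\ Z (zh + v), c (zh + v) zh <= u, L = ell k (zh + v)
        & local_worst_case Z c (ell k) zh u - eps <= L].

Definition growth_const (R : realType) (m K : nat) (nrm : 'rV[R]_m -> R)
    (ell : 'I_K -> 'rV[R]_m -> R) (g : R) (z0 : 'rV[R]_m) (r : R)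
    (zh : 'rV[R]_m) : R :=
  maximum (range (fun k => g + g * nrm (zh - z0) `^ r - ell k zh)).

Definition lipschitz_const (R : realType) (m K : nat) (nrm : 'rV[R]_m -> R)
    (ell : 'I_K -> 'rV[R]_m -> R) (zh : 'rV[R]_m) : R :=
  maximum (range (fun k =>
    maximum [set dual_norm nrm xi | xi in superdifferential (ell k) zh])).

(* Main.v *)
(* The feasible set [{z in Z | c z zh <= u}] is closed since [c] is lower
   semicontinuous and bounded since [c] dominates a power of a norm, so the
   maximum defining S_k is attained; at radius 0 the set is [{zh}]. For p = 1
   the growth bound at a maximizer and the subadditivity of [t |-> t `^ r]
   give the first estimate. For the second, a supergradient [xi] at [zh] gives
   [ell z - ell zh <= inner xi (z - zh) <= dual_norm xi * u `^ p^-1]. Since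
   [maximum] is 0 when no maximum is attained, one must also know that the
   superdifferential is nonempty and compact. Nonemptiness (Hahn-Banach in
   R^m) further yields the upper semicontinuity of concave functions, from
   which all the attainment results and the equivalence of norms follow. *)

Require Import Defs.
From mathcomp Require Import all_boot all_order all_algebra.
From mathcomp Require Import all_classical all_reals all_analysis.
From mathcomp Require Import ring lra.

Set Implicit Arguments.
Unset Strict Implicit.
Unset Printing Implicit Defensive.

Import Order.TTheory GRing.Theory Num.Theory.
Import numFieldNormedType.Exports.

Local Open Scope classical_set_scope.
Local Open Scope ring_scope.

(** * Bilinearity and joint continuity of the inner product *)

Section inner_product.
Variables (R : realType) (m : nat).
Implicit Types (u v w : 'rV[R]_m) (a : R).

Lemma inner_sum u v : inner u v = \sum_j u 0 j * v 0 j.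
Proof. by rewrite /inner mxE; apply: eq_bigr => j _; rewrite mxE. Qed.

Lemma innerDl u v w : inner (u + v) w = inner u w + inner v w.
Proof. by rewrite /inner mulmxDl mxE. Qed.

Lemma innerDr u v w : inner u (v + w) = inner u v + inner u w.
Proof. by rewrite /inner linearD/= mulmxDr mxE. Qed.

Lemma innerZl a u v : inner (a *: u) v = a * inner u v.
Proof. by rewrite /inner -scalemxAl mxE. Qed.

Lemma innerZr a u v : inner u (a *: v) = a * inner u v.
Proof. by rewrite /inner linearZ/= -scalemxAr mxE. Qed.

Lemma inner0l v : inner 0 v = 0.
Proof. by rewrite -(scale0r 0) innerZl mul0r. Qed.

Lemma inner0r u : inner u 0 = 0.
Proof. by rewrite -(scale0r 0) innerZr mul0r. Qed.

Lemma inner_deltar u j : inner u (delta_mx 0 j) = u 0 j.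
Proof.
rewrite inner_sum (bigD1 j)//= mxE !eqxx mulr1 big1 ?addr0// => i ij.
by rewrite mxE (negbTE ij) andbF mulr0.
Qed.

Lemma inner_deltal v j : inner (delta_mx 0 j) v = v 0 j.
Proof.
rewrite inner_sum (bigD1 j)//= mxE !eqxx mul1r big1 ?addr0// => i ij.
by rewrite mxE (negbTE ij) andbF mul0r.
Qed.

Lemma continuous_inner :
  continuous (fun w : 'rV[R]_m * 'rV[R]_m => inner w.1 w.2).
Proof.
rewrite [X in continuous X](_ : _ =
    fun w : 'rV[R]_m * 'rV[R]_m => \sum_j w.1 0 j * w.2 0 j); last first.
  by apply/funext => w'; rewrite inner_sum.
apply: continuous_big; first exact: add_continuous.
move=> j _ w; apply: cvgM.
- by apply: (@continuous_comp _ _ _ fst (fun v => v 0 j));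
    [exact: cvg_fst | exact: coord_continuous].
- by apply: (@continuous_comp _ _ _ snd (fun v => v 0 j));
    [exact: cvg_snd | exact: coord_continuous].
Qed.

Lemma continuous_innerr u : continuous (inner u).
Proof.
move=> v.
apply: (@continuous2_cvg _ _ _ _ (nbhs v) _ (fun=> u) id (@inner R m)).
- exact: (@continuous_inner (u, v)).
- exact: cvg_cst.
- exact: cvg_id.
Qed.

Lemma continuous_innerl v : continuous (fun u => inner u v).
Proof.
move=> u.
apply: (@continuous2_cvg _ _ _ _ (nbhs u) _ id (fun=> v) (@inner R m)).
- exact: (@continuous_inner (u, v)).
- exact: cvg_id.
- exact: cvg_cst.
Qed.

End inner_product.

(** * Attainment of maxima on finite families and on compact sets *)

Section maximum.
Variable R : realType.

Lemma maximumP (A : set R) : (exists y, is_maximum A y) ->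
  is_maximum A (maximum A).
Proof. exact: xgetPex. Qed.

(** The index [k] makes the finite range nonempty, so a greatest element exists and [maximum] does
    not fall back on its default 0. *)
Lemma maximum_range_ge (K : nat) (F : 'I_K -> R) k :
  F k <= maximum (range F).
Proof.
suff /maximumP[_] : exists y, is_maximum (range F) y by apply; exists k.
have [j _ Fj] := @arg_maxP _ _ _ k predT F isT.
exists (F j); split; first by exists j.
by move=> _ [i _ <-]; exact: Fj.
Qed.

Lemma continuous_usc (T : topologicalType) (f : T -> R) z a :
  {for z, continuous f} -> f z < a -> \forall y \near z, f y < a.
Proof. by move=> cf; exact: (@cvgr_lt R _ _ (nbhs_filter z) f _ cf). Qed.

Lemma usc_compact_max (T : topologicalType) (f : T -> R) (A : set T) :
  A !=set0 -> compact A ->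
  (forall z a, f z < a -> \forall y \near z, f y < a) ->
  exists2 z, A z & forall y, A y -> f y <= f z.
Proof.
move=> [z0 Az0] cA usc_f; apply: contrapT => nomax.
have above z : A z -> exists2 y, A y & f z < f y.
  move=> Az; apply: contrapT => noy; apply: nomax; exists z => // y Ay.
  by rewrite leNgt; apply/negP => fzy; apply: noy; exists y.
(* Without a maximizer, the superlevel sets of [f] at values taken on [A] form a nested base of a
   proper filter, which clusters at some [q] in [A]. *)
pose F := filter_from A (fun y => [set z | A z /\ f y <= f z]).
have FF : ProperFilter F.
  apply: filter_from_proper => [|y Ay]; last by exists y.
  apply: filter_from_filter => [|y z Ay Az]; first by exists z0.
  have [fyz|fzy] := leP (f y) (f z).
    by exists z => // w [Aw zw]; split; split => //; exact: le_trans zw.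
  exists y => // w [Aw yw]; split; split => //.
  by apply: le_trans yw; exact: ltW.
have [|q [Aq clq]] := cA F FF; first by exists z0 => // w [].
(* Near [q] all values stay below [f y], yet [q] is a cluster point of the points with value at
   least [f y]. *)
have [y Ay fqy] := above _ Aq.
have Fy : F [set z | A z /\ f y <= f z] by exists y.
have [w [[_ fyw]]] := clq _ _ Fy (usc_f _ _ fqy).
by rewrite /= ltNge fyw.
Qed.

End maximum.

(** * Supergradients and upper semicontinuity of concave functions *)

Section concave.
Variables (R : realType) (m : nat).
Implicit Types (f : 'rV[R]_m -> R) (z v w : 'rV[R]_m).

(** Unnormalized weights let a forward step [t] and a backward step [s] along one direction cancel
    in the extension argument below. *)
Lemma concave_function_weighted f z v w (s t : R) :
  concave_function f -> 0 < s -> 0 < t ->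
  s * f (z + v) + t * f (z + w) <=
    (s + t) * f (z + (s + t)^-1 *: (s *: v + t *: w)).
Proof.
move=> cf s0 t0; have st0 : 0 < s + t by exact: addr_gt0.
have q0 : 0 <= s / (s + t) by rewrite divr_ge0// ltW.
have q1 : s / (s + t) <= 1 by rewrite ler_pdivrMr// mul1r lerDl ltW.
have := cf (Itv01 q0 q1) (z + v) (z + w) (in_setT _) (in_setT _).
rewrite convRE/=.
have -> : conv (Itv01 q0 q1) (z + v : convex_lmodType _) (z + w) =
    z + (s + t)^-1 *: (s *: v + t *: w).
  rewrite /conv/= /unstable.onem.
  have -> : 1 - s / (s + t) = t / (s + t) by field; rewrite gt_eqF.
  rewrite !scalerDr !scalerA addrACA -scalerDl; congr (_ + (_ + _)).
  - by rewrite -mulrDl divff ?scale1r// gt_eqF.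
  - by rewrite mulrC.
  - by rewrite mulrC.
rewrite /unstable.onem; set fc := f (_ + _ *: _).
have -> : 1 - s / (s + t) = t / (s + t) by field; rewrite gt_eqF.
move=> h; rewrite -ler_pdivrMl//.
have -> : (s + t)^-1 * (s * f (z + v) + t * f (z + w)) =
    s / (s + t) * f (z + v) + t / (s + t) * f (z + w) by ring.
lra.
Qed.

(* Hahn-Banach, one coordinate at a time: [xi] is a supergradient along the
   first [j] coordinate directions. *)
Lemma partial_supergradient f z (j : nat) : concave_function f -> (j <= m)%N ->
  exists xi : 'rV[R]_m, forall v, (forall i : 'I_m, (j <= i)%N -> v 0 i = 0) ->
    f (z + v) <= f z + inner xi v.
Proof.
move=> cf; elim: j => [_|j IH ltjm].
  exists 0 => v v0; have -> : v = 0 by apply/rowP => i; rewrite mxE v0.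
  by rewrite inner0l !addr0.
have [xi xiP] := IH (ltnW ltjm).
pose jo := Ordinal ltjm; pose e : 'rV[R]_m := delta_mx 0 jo.
pose E := [set v : 'rV[R]_m | forall i : 'I_m, (j <= i)%N -> v 0 i = 0].
have E0 : E 0 by move=> i _; rewrite mxE.
(* Forward slopes along [e], corrected by [xi]. Each is at most each backward slope, by concavity
   and the induction hypothesis at the weighted mean, so [sup L] separates the two families. *)
pose L := [set ((f (z + (q.1 + q.2 *: e)) - f z - inner xi q.1) / q.2)
          | q in [set q : 'rV[R]_m * R | E q.1 /\ 0 < q.2]].
have ubL w s : E w -> 0 < s ->
    ubound L ((f z - f (z + (w - s *: e)) + inner xi w) / s).
  move=> Ew s0 _ [[v t] [/= Ev t0] <-].
  have st0 : 0 < s + t by exact: addr_gt0.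
  have := concave_function_weighted z (v + t *: e) (w - s *: e) cf s0 t0.
  have -> : s *: (v + t *: e) + t *: (w - s *: e) = s *: v + t *: w.
    by rewrite !scalerDr addrACA scalerN !scalerA mulrC subrr addr0.
  have Evw : E ((s + t)^-1 *: (s *: v + t *: w)).
    by move=> i ji; rewrite !mxE Ev// Ew// !mulr0 addr0 mulr0.
  have := xiP _ Evw; rewrite innerZr innerDr !innerZr -(ler_pM2l st0).
  rewrite mulrDr mulVKf ?gt_eqF// ler_pdivrMr// mulrAC ler_pdivlMr//.
  lra.
have L0 : L !=set0.
  by exists ((f (z + (0 + 1 *: e)) - f z - inner xi 0) / 1), (0, 1).
have hL : has_ubound L.
  by exists ((f z - f (z + (0 - 1 *: e)) + inner xi 0) / 1); exact: ubL.
(* The coordinate [jo] of [xi] is replaced by [sup L]. *)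
exists (xi + (sup L - xi 0 jo) *: e) => v Ev.
pose t := v 0 jo; pose w := v - t *: e.
have Ew : E w.
  move=> i; rewrite leq_eqVlt => /predU1P[ji|ji].
    have -> : i = jo by apply/val_inj.
    by rewrite !mxE !eqxx mulr1 subrr.
  rewrite !mxE Ev//= (_ : i == jo = false) ?mulr0 ?subr0//.
  by apply/negbTE; rewrite -val_eqE/= gtn_eqF.
have vE : v = w + t *: e by rewrite subrK.
have -> : inner (xi + (sup L - xi 0 jo) *: e) v = inner xi w + t * sup L.
  rewrite innerDl innerZl inner_deltal [in inner xi v]vE innerDr innerZr.
  by rewrite inner_deltar -/t; ring.
(* Negative [t] uses that backward slopes bound [L], positive [t] that [sup L] bounds forward
   slopes, and [t = 0] the induction hypothesis. *)
have [t0|t0|t0] := ltgtP t 0.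
- have : sup L <= (f z - f (z + (w - (- t) *: e)) + inner xi w) / (- t).
    by apply: ge_sup => //; apply: ubL => //; rewrite oppr_gt0.
  by rewrite ler_pdivlMr ?oppr_gt0// scaleNr opprK -vE; lra.
- have : (f (z + (w + t *: e)) - f z - inner xi w) / t <= sup L.
    by apply: ub_le_sup => //; exists (w, t).
  by rewrite ler_pdivrMr// -vE; lra.
- by rewrite vE t0 scale0r addr0 mul0r addr0; exact: xiP.
Qed.

Lemma superdifferential_nonempty f z : concave_function f ->
  superdifferential f z !=set0.
Proof.
move=> cf; have [xi xiP] := partial_supergradient z cf (leqnn m).
exists xi => y; rewrite -{1}(subrK z y) addrC; apply: xiP => i.
by rewrite leqNgt ltn_ord.
Qed.

(** A supergradient gives a continuous affine majorant that agrees with [f] at [z]. *)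
Lemma concave_usc f z (a : R) : concave_function f -> f z < a ->
  \forall y \near z, f y < a.
Proof.
move=> cf fza; have [xi xiP] := superdifferential_nonempty z cf.
have lt_xi : inner xi z < inner xi z + (a - f z) by lra.
have := continuous_usc (@continuous_innerr R m xi z) lt_xi.
apply: (@filterS _ (nbhs z)) => y xiy; apply: le_lt_trans (xiP y) _.
by rewrite innerDr -scaleN1r innerZr; lra.
Qed.

Lemma rV_bounded_closed_compact (A : set 'rV[R]_m) (M : R) :
  closed A -> (forall v, A v -> `|v| <= M) -> compact A.
Proof.
move=> clA AM; apply: bounded_closed_compact => //.
exists M; split; first exact: num_real.
by move=> x ltMx v Av; apply: le_trans (AM v Av) (ltW ltMx).
Qed.

(** An intersection of closed half-spaces; testing the inequality at [z] plus and minus the [j]-th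
    basis vector bounds the [j]-th coordinate by [d j]. *)
Lemma superdifferential_compact f z :
  compact (superdifferential f z).
Proof.
pose d j := `|f (z + delta_mx 0 j) - f z| + `|f (z - delta_mx 0 j) - f z|.
apply: (@rV_bounded_closed_compact _ (\sum_j d j)).
  rewrite (_ : superdifferential f z = \bigcap_(y in setT)
      ((fun xi => inner xi (y - z)) @^-1` [set t | f y - f z <= t]));
    last first.
    apply/seteqP; split => [xi xiP y _ /=|xi xiP y]; first by rewrite lerBlDl.
    by have := xiP y I; rewrite /= lerBlDl.
  apply: closed_bigI => y _; apply: preimage_closed; last exact: closed_ge.
  by move=> xi _; exact: continuous_innerl.
have sumd_ge0 (P : pred 'I_m) : 0 <= \sum_(j | P j) d j.
  by apply: sumr_ge0 => j _; rewrite addr_ge0.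
move=> xi xiP; rewrite /Num.Def.normr/= mx_normrE.
apply: bigmax_le => [|[i j] _ /=].
  exact: sumd_ge0.
rewrite (ord1 i) (bigD1 j)//=.
apply: le_trans (_ : _ <= d j) _; last by rewrite lerDl; exact: sumd_ge0.
have := xiP (z + delta_mx 0 j).
rewrite (addrAC z) subrr add0r inner_deltar => xi1.
have := xiP (z - delta_mx 0 j); rewrite (addrAC z) subrr add0r.
rewrite -[in inner _ _]scaleN1r innerZr inner_deltar => xi2.
have := ler_norm (f (z - delta_mx 0 j) - f z).
have := ler_norm (f (z + delta_mx 0 j) - f z).
have := ler_norm (- (f (z - delta_mx 0 j) - f z)); rewrite normrN.
have := ler_norm (- (f (z + delta_mx 0 j) - f z)); rewrite normrN.
rewrite ler_norml /d; lra.
Qed.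

End concave.

(** * Norms on R^m and their duals *)

Section norm.
Variables (R : realType) (m : nat) (nrm : 'rV[R]_m -> R).
Hypothesis nrm_norm : is_norm nrm.

Lemma is_norm0 : nrm 0 = 0.
Proof. by rewrite -(scale0r 0) (norm_homogeneous nrm_norm) normr0 mul0r. Qed.

Lemma is_normN_concave : concave_function (fun v => - nrm v).
Proof.
move=> t v w _ _; rewrite !opprK convRE/=.
apply: le_trans (norm_triangle nrm_norm _ _) _.
by rewrite !(norm_homogeneous nrm_norm) !ger0_norm// subr_ge0.
Qed.

Lemma is_norm_lsc v (a : R) : a < nrm v -> \forall w \near v, a < nrm w.
Proof.
move=> av; have := @concave_usc _ _ _ v (- a) is_normN_concave.
by rewrite ltrN2 => /(_ av); apply: (@filterS _ (nbhs v)) => w; rewrite ltrN2.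
Qed.

(* Half of the equivalence of norms on R^m; [`|v|] is the max norm. *)
Lemma max_norm_le_norm : exists2 C : R, 0 < C & forall v, `|v| <= C * nrm v.
Proof.
pose A := [set v : 'rV[R]_m | `|v| = 1].
have scaleA v : v != 0 -> A (`|v|^-1 *: v).
  move=> v0; rewrite /A/= normrZ ger0_norm ?invr_ge0//.
  by rewrite mulVf// normr_eq0.
(* An empty unit sphere means that 0 is the only vector. *)
have [A0|/set0P A0] := eqVneq A set0.
  exists 1 => // v; have [->|v0] := eqVneq v 0.
    by rewrite normr0 is_norm0 mulr0.
  by have := scaleA v v0; rewrite A0.
have cA : compact A.
  apply: (@rV_bounded_closed_compact R m _ 1) => [|v ->//].
  apply: (@preimage_closed _ _ (fun v : 'rV[R]_m => `|v|) [set 1]).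
    by move=> v _; exact: norm_continuous.
  exact: closed_eq.
(* The norm attains its minimum on the max-norm sphere; it is positive by definiteness, and its
   inverse serves as [C]. *)
have [z Az zP] : exists2 z, A z & forall v, A v -> - nrm v <= - nrm z.
  apply: usc_compact_max => // z a za.
  exact: concave_usc is_normN_concave za.
have nz0 : 0 < nrm z.
  rewrite lt_def (norm_ge0 nrm_norm) andbT.
  apply/eqP => /(norm_definite nrm_norm) z0.
  by move: Az; rewrite /A/= z0 normr0 => /esym/eqP; rewrite oner_eq0.
exists (nrm z)^-1; first by rewrite invr_gt0.
move=> v; rewrite ler_pdivlMl//; have [->|v0] := eqVneq v 0.
  by rewrite normr0 is_norm0 mulr0.
have := zP _ (scaleA v v0); rewrite (norm_homogeneous nrm_norm) lerN2.
rewrite ger0_norm ?invr_ge0// ler_pdivlMl ?normr_gt0//.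
by rewrite mulrC.
Qed.

Lemma norm_sublevel_closed (a : R) : closed [set v | nrm v <= a].
Proof.
move=> v clv /=; rewrite leNgt; apply/negP => /is_norm_lsc/clv[w [/= wa]].
by rewrite ltNge wa.
Qed.

Lemma norm_ball_compact : compact [set v | nrm v <= 1].
Proof.
have [C C0 CP] := max_norm_le_norm.
apply: (@rV_bounded_closed_compact R m _ C); first exact: norm_sublevel_closed.
move=> v /= v1; apply: le_trans (CP v) _.
by rewrite -[leRHS]mulr1 ler_pM2l.
Qed.

(** Compactness of the unit ball makes the set under [sup] bounded above, so that [sup] is a genuine
    upper bound. *)
Lemma inner_le_dual_norm_ball xi v :
  nrm v <= 1 -> inner xi v <= dual_norm nrm xi.
Proof.
move=> v1; apply: ub_le_sup; last by exists v.
have [|||z _ zP] := @usc_compact_max R _ (inner xi) [set v | nrm v <= 1].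
- by exists v.
- exact: norm_ball_compact.
- by move=> z a; exact: (continuous_usc (@continuous_innerr R m xi z)).
by exists (inner xi z) => _ [w w1 <-]; exact: zP.
Qed.

Lemma dual_norm_ge0 xi : 0 <= dual_norm nrm xi.
Proof.
by rewrite -(inner0r xi); apply: inner_le_dual_norm_ball; rewrite is_norm0.
Qed.

Lemma inner_le_dual_norm xi v : inner xi v <= dual_norm nrm xi * nrm v.
Proof.
have [->|v0] := eqVneq v 0; first by rewrite inner0r is_norm0 mulr0.
have nv0 : 0 < nrm v.
  rewrite lt_def (norm_ge0 nrm_norm) andbT.
  by apply: contra_neq v0; exact: norm_definite nrm_norm _.
rewrite -ler_pdivrMr// mulrC -innerZr; apply: inner_le_dual_norm_ball.
by rewrite (norm_homogeneous nrm_norm) gtr0_norm ?invr_gt0// mulVf ?gt_eqF.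
Qed.

(* A maximizer of the bilinear form over the compact product of the
   superdifferential and the unit ball has maximal dual norm, which spares the
   continuity of the dual norm. *)
Lemma dual_norm_superdifferential_max (f : 'rV[R]_m -> R) z :
  superdifferential f z !=set0 ->
  exists y, is_maximum [set dual_norm nrm xi | xi in superdifferential f z] y.
Proof.
move=> [xi0 xi0P].
have [|||[xi v] [/= xiP v1] maxP] := @usc_compact_max R _
  (fun w => inner w.1 w.2) (superdifferential f z `*` [set v | nrm v <= 1]).
- by exists (xi0, 0); split => //=; rewrite is_norm0.
- by apply: compact_setX; [exact: superdifferential_compact |
    exact: norm_ball_compact].
- by move=> w a; exact: (continuous_usc (@continuous_inner R m w)).
exists (dual_norm nrm xi); split; first by exists xi.
move=> _ [xi' xi'P <-]; apply: ge_sup.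
  by exists (inner xi' 0), 0 => //=; rewrite is_norm0.
move=> _ [w w1 <-]; apply: le_trans (inner_le_dual_norm_ball xi v1).
exact: (maxP (xi', w)).
Qed.

End norm.

(** A fraction [x / (a + b)] in [0, 1] is at most its [r]-th power; this is multiplied by the [r]-th
    power of [a + b] and summed over [x = a] and [x = b]. *)
Lemma powR_subadditive (R : realType) (r a b : R) :
  0 <= r -> r <= 1 -> 0 <= a -> 0 <= b -> (a + b) `^ r <= a `^ r + b `^ r.
Proof.
move=> r0 r1 a0 b0; have [ab0|ab0] := eqVneq (a + b) 0.
  have [-> ->] : a = 0 /\ b = 0 by lra.
  by rewrite addr0 lerDl powR_ge0.
have s0 : 0 < a + b by rewrite lt_def ab0 addr_ge0.
have frac_le x : 0 <= x -> x <= a + b ->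
    x / (a + b) * (a + b) `^ r <= x `^ r.
  move=> x0 xs; have [->|xn0] := eqVneq x 0; first by rewrite !mul0r powR_ge0.
  have xp : 0 < x by rewrite lt_def xn0.
  have /(@ger1_powR _ _ r) : 0 < x / (a + b) <= 1.
    by rewrite divr_gt0//= ler_pdivrMr// mul1r.
  move=> /(_ r1) fr.
  rewrite -[in leRHS](divfK ab0 x) powRM ?divr_ge0 ?(ltW s0)//.
  by rewrite ler_wpM2r ?powR_ge0.
have := lerD (frac_le a a0 _) (frac_le b b0 _).
rewrite -mulrDl -mulrDl divff// mul1r; apply; lra.
Qed.

(** * Compactness of cost sublevel sets and the local worst case *)

Section feasible_set.
Variables (R : realType) (m : nat) (Z : set 'rV[R]_m).
Variables (c : 'rV[R]_m -> 'rV[R]_m -> R) (nrm : 'rV[R]_m -> R) (p : R).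
Hypotheses (hc : transportation_cost Z c) (clZ : closed Z).
Hypotheses (nrm_norm : is_norm nrm) (p1 : 1 <= p).
Hypothesis cost_ge : forall z zh, Z z -> Z zh -> nrm (z - zh) `^ p <= c z zh.
Variables (zh : 'rV[R]_m) (Zzh : Z zh).

Let p0 : 0 < p. Proof. exact: lt_le_trans p1. Qed.

Lemma norm_le_cost_root z (u : R) : Z z -> c z zh <= u ->
  nrm (z - zh) <= u `^ p^-1.
Proof.
move=> Zz zu; have nu := le_trans (cost_ge Zz Zzh) zu.
have u0 : 0 <= u := le_trans (powR_ge0 _ _) nu.
rewrite -[leLHS]powRr1 ?(norm_ge0 nrm_norm)// -(divff (lt0r_neq0 p0)) powRrM.
by apply: ge0_ler_powR; rewrite ?invr_ge0 ?(ltW p0)// nnegrE ?powR_ge0.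
Qed.

Lemma cost_sublevel_closed (u : R) : closed [set z | Z z /\ c z zh <= u].
Proof.
move=> z clz; have Zz : Z z.
  by apply: clZ => U /clz[y [[Zy _] Uy]]; exists y.
split => //=; rewrite leNgt; apply/negP => uz.
have lsc_c := cost_lsc hc; have [V nV Vc] := lsc_c (z, zh) u uz.
have ZZz : (Z `*` Z) (z, zh) by [].
(* The subspace neighbourhood [V] is the trace of an ambient one, whose slice at [zh] is a
   neighbourhood of [z] and so meets the sublevel set. *)
have [W nW VW] := (nbhs_subspace_ex (V : set ('rV[R]_m * 'rV[R]_m)) ZZz).1 nV.
have nWz : nbhs z [set y | W (y, zh)].
  have [[A B] [/= nA nB] AB] := nW.
  apply: filterS nA => y Ay; apply: AB; split => //=; exact: nbhs_singleton nB.
have [y [[Zy yu] Wy]] := clz _ nWz.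
have [Vy _] : (V `&` (Z `*` Z)) (y, zh) by rewrite VW; split.
by have := Vc _ Vy; rewrite /= lte_fin ltNge yu.
Qed.

Lemma cost_sublevel_compact (u : R) : compact [set z | Z z /\ c z zh <= u].
Proof.
have [C C0 CP] := max_norm_le_norm nrm_norm.
apply: (@rV_bounded_closed_compact R m _ (C * u `^ p^-1 + `|zh|)).
  exact: cost_sublevel_closed.
move=> z [Zz zu]; rewrite -(subrK zh z); apply: le_trans (ler_normD _ _) _.
rewrite lerD2r; apply: le_trans (CP _) _.
by rewrite ler_pM2l//; exact: norm_le_cost_root.
Qed.

Lemma local_worst_case_attained (f : 'rV[R]_m -> R) (u : R) :
  concave_function f -> 0 <= u ->
  exists z, [/\ Z z, c z zh <= u & local_worst_case Z c f zh u = f z].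
Proof.
move=> cf u0; rewrite /local_worst_case.
have [|||z [Zz zu] zP] := @usc_compact_max R _ f [set z | Z z /\ c z zh <= u].
- by exists zh; split => //; rewrite (cost_diag hc).
- exact: cost_sublevel_compact.
- by move=> z a; exact: concave_usc.
have /maximumP[[v [Zv vu] <-] _] : exists y, is_maximum
    [set f (zh + v) | v in [set v | Z (zh + v) /\ c (zh + v) zh <= u]] y.
  exists (f z); split.
    by exists (z - zh) => /=; rewrite addrC subrK.
  by move=> _ [v vP <-]; exact: zP.
by exists (zh + v).
Qed.

Lemma local_worst_case_radius0 (f : 'rV[R]_m -> R) : concave_function f ->
  local_worst_case Z c f zh 0 = f zh.
Proof.
move=> cf; have [z [Zz z0 ->]] := local_worst_case_attained cf (lexx 0).
(* Since [p^-1] is nonzero, the root of the radius 0 is 0 and not 1. *)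
have := norm_le_cost_root Zz z0; rewrite powR0 ?invr_eq0 ?gt_eqF// => nz.
congr (f _); apply/subr0_eq/(norm_definite nrm_norm)/eqP.
by rewrite eq_le nz (norm_ge0 nrm_norm).
Qed.

End feasible_set.

(** * The two growth estimates *)

Theorem lemma8 (R : realType) (n m N K : nat)
    (X : set 'rV[R]_n) (Z : set 'rV[R]_m)
    (c : 'rV[R]_m -> 'rV[R]_m -> R)
    (zhat : 'I_N -> 'rV[R]_m) (rho : R)
    (ell : 'I_K -> 'rV[R]_n -> 'rV[R]_m -> R)
    (nrm : 'rV[R]_m -> R) (p : R)
    (hc : transportation_cost Z c)
    (hzhat : forall j, Z (zhat j))
    (hrho : 0 < rho)
    (hreg : regularity X Z c zhat rho ell nrm p)
    (x : 'rV[R]_n) (hx : X x)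
    (horacle : local_worst_case_oracle Z c (fun k => ell k x))
    (k : 'I_K) (i : 'I_N) (u : R) (hu : 0 <= u) :
  let S (t : R) : R := local_worst_case Z c (ell k x) (zhat i) t in
  (p = 1 -> forall (g : R) (z0 : 'rV[R]_m) (r : R),
     growth_bound Z nrm (loss ell x) g z0 r ->
     S u - S 0 <=
       growth_const nrm (fun k' => ell k' x) g z0 r (zhat i) + g * u `^ r)
  /\
  S u - S 0 <= lipschitz_const nrm (fun k' => ell k' x) (zhat i) * u `^ p^-1.
Proof.
have nrm_norm := reg_norm hreg.
have p1 := reg_p hreg; have p0 : 0 < p by exact: lt_le_trans p1.
have clZ := reg_Z_closed hreg; have cost_ge := reg_cost hreg.
have cf := reg_ell_concave hreg k x.
have Zzh := hzhat i.
move=> S; rewrite /S.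
rewrite (local_worst_case_radius0 hc clZ nrm_norm p1 cost_ge)//.
have [z [Zz zu ->]] := local_worst_case_attained hc clZ nrm_norm p1 cost_ge
  Zzh cf hu.
have nzu := norm_le_cost_root nrm_norm p1 cost_ge Zzh Zz zu.
split.
  move=> pE g z0 r [g0 Zz0 /andP[r0 r1] growth].
  move: nzu; rewrite pE invr1 powRr1// => nzu.
  have le_loss : ell k x z <= loss ell x z.
    exact: (maximum_range_ge (fun k => ell k x z) k).
  have le_const := maximum_range_ge
    (fun k => g + g * nrm (zhat i - z0) `^ r - ell k x (zhat i)) k.
  apply: le_trans (lerD le_const (lexx _)) => /=.
  (* The triangle inequality through [zhat i] is followed by subadditivity of the [r]-th power. *)
  have n_le : nrm (z - z0) `^ r <= u `^ r + nrm (zhat i - z0) `^ r.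
    have n0 v := norm_ge0 nrm_norm v.
    apply: le_trans (powR_subadditive r0 (ltW r1) hu (n0 _)).
    apply: ge0_ler_powR; rewrite ?nnegrE ?addr_ge0//.
    rewrite -(subrKA (zhat i)); apply: le_trans (norm_triangle nrm_norm _ _) _.
    by rewrite lerD2r.
  have := le_trans le_loss (growth z Zz).
  by move: n_le; rewrite -(ler_pM2l g0); lra.
(* One supergradient suffices: its dual norm is below the inner maximum, attained by compactness,
   and hence below the maximum over all pieces. *)
have [xi xiP] := superdifferential_nonempty (zhat i) cf.
have /maximumP[_ max_ge] := dual_norm_superdifferential_max nrm_norm
  (ex_intro _ xi xiP).
have xi_le : dual_norm nrm xi <=
    lipschitz_const nrm (fun k' => ell k' x) (zhat i).
  apply: le_trans (max_ge _ _) _; first by exists xi.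
  exact: (maximum_range_ge (fun k => maximum
    [set dual_norm nrm xi | xi in superdifferential (ell k x) (zhat i)]) k).
rewrite lerBlDl; apply: le_trans (xiP z) _; rewrite lerD2l.
apply: le_trans (inner_le_dual_norm nrm_norm _ _) _.
by apply: ler_pM => //; [exact: dual_norm_ge0 | exact: norm_ge0 nrm_norm _].
Qed.
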